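(* Let $G=(V,E,m,\mu)$ be an unweighted physical graph satisfying the $\mathrm{CD}(0,\infty)$ condition with girth at least five. Then the graph $(V,E)$ is (isomorphic to) one of the following: (1) $P_k$ ($k\geq 1$), $C_n$ ($n\geq 5$), $P_{\mathbb{Z}}$, or $P_{\mathbb{N}}$; (2) $\mathrm{Star}_n$ ($n\geq 3$).
   Context: All graphs $(V,E)$ are undirected, connected, locally finite and simple (finite or infinite, with more than one vertex). Write $x\sim y$ if $\{x,y\}\in E$. An unweighted physical graph is a graph $(V,E)$ with edge weights $\mu_{xy}=1$ for all $\{x,y\}\in E$ and vertex weights $m_x=1$ for all $x\in V$. For $f,g:V\to\mathbb{R}$: $\Delta f(x)=\frac{1}{m_x}\sum_{y\sim x}\mu_{xy}(f(y)-f(x))=\sum_{y\sim x}(f(y)-f(x))$, $\Gamma(f,g)=\frac12(\Delta(fg)-f\Delta g-g\Delta f)$, $\Gamma(f)=\Gamma(f,f)$, $\Gamma_2(f)=\frac12\Delta\Gamma(f)-\Gamma(f,\Delta f)$. The graph satisfies $\mathrm{CD}(0,\infty)$ if $\Gamma_2(f)(x)\geq 0$ for all $f:V\to\mathbb{R}$ and all $x\in V$. A cycle of length $k>2$ is a walk $x_0\sim x_1\sim\cdots\sim x_k$ with $x_0=x_k$ and $x_0,\dots,x_{k-1}$ pairwise distinct. The girth of a vertex is the minimal length of cycles passing through it ($\infty$ if there is none), and the girth of the graph is the infimum of the girths of its vertices. $P_k$ is the path with $k$ edges ($k+1$ vertices); $C_n$ is the cycle graph with $n$ vertices; $P_{\mathbb{Z}}$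 (resp. $P_{\mathbb{N}}$) is the graph on $\mathbb{Z}$ (resp. $\mathbb{N}$) with $i\sim i+1$ for all $i$ (infinite line, resp. infinite half line); $\mathrm{Star}_n$ is the star with one center joined to $n$ leaves. *)

(* Defs.v *)
From HB Require Import structures.
From mathcomp Require Import all_boot all_order all_algebra.
From mathcomp Require Import all_classical all_reals all_analysis.

Set Implicit Arguments.
Unset Strict Implicit.
Unset Printing Implicit Defensive.

Import Order.TTheory GRing.Theory Num.Theory.

Local Open Scope classical_set_scope.
Local Open Scope ring_scope.

Record graph := Graph {
  vertex :> choiceType;
  adj : rel vertex;
  adj_sym : symmetric adj;
  adj_irrefl : irreflexive adj;
  adj_connected : forall x y : vertex, exists2 p, path adj x p & last x p = y;
  adj_locally_finite : forall x : vertex, finite_set [set y | adj x y];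
  graph_nontrivial : exists x y : vertex, x <> y }.

Arguments adj {g} : rename.

(* [edge_weight x y] is only meaningful when [adj x y]. *)
Record weighted_graph (R : realType) := WeightedGraph {
  base_graph :> graph;
  edge_weight : base_graph -> base_graph -> R;
  vertex_weight : base_graph -> R;
  edge_weight_sym : forall x y, adj x y -> edge_weight x y = edge_weight y x;
  edge_weight_gt0 : forall x y, adj x y -> 0 < edge_weight x y;
  vertex_weight_gt0 : forall x, 0 < vertex_weight x }.

Definition unweighted_physical (R : realType) (G : weighted_graph R) : Prop :=
  (forall x y : G, adj x y -> edge_weight x y = 1) /\
  (forall x : G, vertex_weight x = 1).

Section CurvatureDimension.
Context (R : realType) (G : weighted_graph R).
Implicit Types f g : G -> R.

Definition laplacian f : G -> R := fun x =>
  (vertex_weight x)^-1 *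
    \sum_(y \in [set y | adj x y]) edge_weight x y * (f y - f x).

Definition Gamma f g : G -> R := fun x =>
  2^-1 * (laplacian (fun y => f y * g y) x
          - f x * laplacian g x - g x * laplacian f x).

Definition Gamma2 f : G -> R := fun x =>
  2^-1 * laplacian (Gamma f f) x - Gamma f (laplacian f) x.

Definition CD_0_infty : Prop := forall f (x : G), 0 <= Gamma2 f x.

End CurvatureDimension.

(* The list [:: x_0; ...; x_{k-1}] encodes the closed walk
   x_0 ~ x_1 ~ ... ~ x_{k-1} ~ x_0, whose length is the size of the list. *)
Definition graph_cycle (G : graph) (c : seq G) : Prop :=
  ucycle (@adj G) c /\ (2 < size c)%N.

Definition vertex_girth (R : realType) (G : graph) (x : G) : \bar R :=
  ereal_inf [set ((size c)%:R : R)%:E | c in [set c | graph_cycle c /\ x \in c]].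

Definition girth (R : realType) (G : graph) : \bar R :=
  ereal_inf (range (@vertex_girth R G)).

Definition graph_iso (V W : Type) (e : rel V) (e' : rel W) : Prop :=
  exists2 h : V -> W, bijective h & forall x y, e x y = e' (h x) (h y).

Definition path_adj (k : nat) : rel 'I_k.+1 :=
  fun i j => (i.+1 == j :> nat) || (j.+1 == i :> nat).

(* A simple graph only for n >= 3. *)
Definition cycle_adj (n : nat) : rel 'I_n :=
  fun i j => (i.+1 %% n == j :> nat)%N || (j.+1 %% n == i :> nat)%N.

Definition line_adj : rel int := fun i j => (i + 1 == j) || (j + 1 == i).

Definition half_line_adj : rel nat := fun i j => (i.+1 == j) || (j.+1 == i).

(* [None] is the center, [Some i] are the leaves. *)
Definition star_adj (n : nat) : rel (option 'I_n) :=
  fun u v => isSome u != isSome v.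

(* Main.v *)
Require Import Defs.
From HB Require Import structures.
From mathcomp Require Import all_boot all_order all_algebra.
From mathcomp Require Import all_classical all_reals all_analysis.
From mathcomp Require Import ring lra zify.

Set Implicit Arguments.
Unset Strict Implicit.
Unset Printing Implicit Defensive.

Import Order.TTheory GRing.Theory Num.Theory.

(** Both the curvature assumption and the girth assumption act only through the
    ball of radius two.  Completing squares in the Bochner operator gives
    (lemma [Gamma2E], with d the degree)

      2 Gamma2 f (x) = (sum_y (f y - f x))^2
        + 1/2 sum_y sum_(z ~ y) (f z - 2 f y + f x)^2
        - 1/2 sum_y (d x + d y) (f y - f x)^2,

    where y ranges over the neighbours of x.  When x lies on no triangle and no
    square, the vertices at distance two from x are attached to a single y each,
    so f can be extended linearly along every x ~ y ~ z, and every second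
    difference with z <> x vanishes.  Choosing f = 1 at one neighbour a, f = -1
    at another neighbour b and 0 at the other neighbours kills the first term as
    well, and nonnegativity of Gamma2 becomes d a + d b + 2 d x <= 8
    (lemma [CD_deg_bound]).

    If d x >= 3 for some x, any two neighbours of x have degrees of sum at most
    2; they are leaves, and by connectivity the graph is a star.  Otherwise all
    degrees are at most two.  A cycle then exhausts the graph, and its length is
    at least five by the girth assumption.  Without a cycle, walks that do not
    backtrack never return, hence parametrise the graph injectively: by N or by
    an initial segment of N when they start at a leaf, by Z when there is no
    leaf.  All the isomorphisms are obtained from one principle
    ([iso_of_injective_covering]): an injective homomorphism into a connected
    graph which reaches every neighbour of its image is an isomorphism. *)

(** * Short cycles *)

Lemma cycle_size_ge5 (R : realType) (G : graph) (c : seq G) :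
  ((5%:R : R)%:E <= girth R G)%E -> graph_cycle c -> (5 <= size c)%N.
Proof.
move=> hg hc; case: (hc) => _; case: c hc => [//|x c] hc _.
have hx : (girth R G <= vertex_girth R x)%E by apply: ereal_inf_lbound; exists x.
have hv : (vertex_girth R x <= ((size (x :: c))%:R : R)%:E)%E.
  by apply: ereal_inf_lbound; exists (x :: c) => //; split=> //; exact: mem_head.
by have := le_trans hg (le_trans hx hv); rewrite lee_fin ler_nat.
Qed.

Definition no_short_cycle (G : graph) :=
  forall c : seq G, graph_cycle c -> (5 <= size c)%N.

Lemma adj_neq (G : graph) (x y : G) : adj x y -> (x == y) = false.
Proof. by move=> h; apply/eqP => e; move: h; rewrite e adj_irrefl. Qed.

Lemma no_triangle (G : graph) (x y z : G) :
  no_short_cycle G -> adj x y -> adj y z -> adj x z = false.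
Proof.
move=> hG hxy hyz; apply/negP => hxz.
have : graph_cycle [:: x; y; z] by
  rewrite /graph_cycle /ucycle /= !inE hxy hyz (adj_sym z) hxz
    (adj_neq hxy) (adj_neq hyz) (adj_neq hxz).
by move/hG.
Qed.

Lemma no_square (G : graph) (x y z w : G) :
  no_short_cycle G -> adj x y -> adj x z -> y <> z -> adj y w -> adj z w ->
  w = x.
Proof.
move=> hG hxy hxz /eqP/negbTE hyz hyw hzw; apply/eqP/negPn/negP => /negbTE hwx.
have : graph_cycle [:: x; y; w; z] by
  rewrite /graph_cycle /ucycle /= !inE hxy hyw (adj_sym w) hzw (adj_sym z) hxz
    (eq_sym x w) hwx (adj_neq hxy) (adj_neq hxz) hyz (adj_neq hyw) (eq_sym w z) (adj_neq hzw).
by move/hG.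
Qed.

(** * Curvature bounds the degrees *)

Local Open Scope ring_scope.

Definition nbr (G : graph) (x : G) : seq G :=
  finmap.enum_fset (fset_set [set y | adj x y]%classic).

Lemma mem_nbr (G : graph) (x y : G) : (y \in nbr x) = adj x y.
Proof.
have := in_fset_set (adj_locally_finite x) y; rewrite /nbr => ->.
by apply/idP/idP; rewrite inE.
Qed.

Lemma nbr_uniq (G : graph) (x : G) : uniq (nbr x).
Proof. exact: finmap.fset_uniq. Qed.

Definition deg (G : graph) (x : G) : nat := size (nbr x).

Lemma deg_gt0 (G : graph) (x y : G) : adj x y -> (0 < deg x)%N.
Proof. by rewrite -mem_nbr /deg; case: (nbr x). Qed.

Lemma sumr_cst_nbr (R : realType) (G : graph) (x : G) (c : R) :
  \sum_(y <- nbr x) c = (deg x)%:R * c.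
Proof. by rewrite big_const_seq count_predT iter_addr_0 mulr_natl. Qed.

Lemma laplacianE (R : realType) (G : weighted_graph R) (f : G -> R) (x : G) :
  unweighted_physical G -> laplacian f x = \sum_(y <- nbr x) (f y - f x).
Proof.
move=> [hw hm]; rewrite /laplacian hm invr1 mul1r fsbig_finite; last first.
  exact: adj_locally_finite.
rewrite [LHS]big_seq [RHS]big_seq; apply: eq_bigr => y.
by rewrite -/(nbr x) mem_nbr => /hw ->; rewrite mul1r.
Qed.

Lemma GammaE (R : realType) (G : weighted_graph R) (f g : G -> R) (x : G) :
  unweighted_physical G ->
  Gamma f g x = 2^-1 * \sum_(y <- nbr x) (f y - f x) * (g y - g x).
Proof.
move=> hG; rewrite /Gamma !laplacianE // !mulr_sumr -!sumrB mulr_sumr.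
by apply: eq_bigr => y _; field.
Qed.

(** Write t = f z - f y and a = f y - f x.  The terms of Gamma2 indexed by y and
    z are t^2 / 2 - a t, up to scaling, which is half of (t - a)^2 - a^2; the
    square is a second difference of f along x ~ y ~ z, and the a^2 are counted
    by the degree of y.  The degree of x comes from subtracting Gamma f x once
    for each neighbour. *)
Lemma Gamma2E (R : realType) (G : weighted_graph R) (f : G -> R) (x : G) :
  unweighted_physical G ->
  Gamma2 f x =
    2^-1 * (\sum_(y <- nbr x) (f y - f x)) ^+ 2
    + 4^-1 * \sum_(y <- nbr x) (\sum_(z <- nbr y) (f z - 2 * f y + f x) ^+ 2
                                - (deg x + deg y)%:R * (f y - f x) ^+ 2).
Proof.
move=> hG; set L := \sum_(y <- nbr x) (f y - f x).
have inner y : Gamma f f y - (f y - f x) * laplacian f y =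
    2^-1 * (\sum_(z <- nbr y) (f z - 2 * f y + f x) ^+ 2
            - (deg y)%:R * (f y - f x) ^+ 2).
  rewrite GammaE // laplacianE // -sumr_cst_nbr -sumrB !mulr_sumr -sumrB.
  by apply: eq_bigr => z _; field.
have outer : Gamma2 f x = 2^-1 * (\sum_(y <- nbr x)
    (Gamma f f y - (f y - f x) * laplacian f y)
    - (deg x)%:R * Gamma f f x + L * laplacian f x).
  rewrite /Gamma2 laplacianE // (GammaE f (laplacian f)) // -sumr_cst_nbr mulr_suml.
  rewrite -sumrB -big_split -mulrBr -sumrB; congr (_ * _).
  by apply: eq_bigr => y _ /=; ring.
rewrite outer (eq_bigr _ (fun y _ => inner y)) laplacianE // GammaE //.
rewrite -/L mulrCA -sumr_cst_nbr.
rewrite [in RHS](eq_bigr (fun y =>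
  2 * (2^-1 * (\sum_(z <- nbr y) (f z - 2 * f y + f x) ^+ 2
            - (deg y)%:R * (f y - f x) ^+ 2))
  - (deg x)%:R * ((f y - f x) * (f y - f x)))); last first.
  by move=> y _; rewrite natrD; field.
rewrite sumrB -!mulr_sumr sumr_cst_nbr.
by field.
Qed.

Lemma sum_nbr_eq (R : realType) (G : graph) (x a : G) (F : G -> R) :
  adj x a -> \sum_(y <- nbr x) F y * (y == a)%:R = F a.
Proof.
move=> hxa; rewrite (bigD1_seq a) ?mem_nbr ?nbr_uniq //= eqxx mulr1 big1 ?addr0 //.
by move=> y /negbTE ->; rewrite mulr0.
Qed.

(** Test function: 1 at a, -1 at b, extended linearly to the vertices behind a
    and b.  The absence of triangles and squares ensures that the prescribed
    values do not conflict. *)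
Lemma CD_deg_bound (R : realType) (G : weighted_graph R) (x a b : G) :
  unweighted_physical G -> CD_0_infty G -> no_short_cycle G ->
  adj x a -> adj x b -> a <> b -> (deg a + deg b + 2 * deg x <= 8)%N.
Proof.
move=> hG hCD hcyc hxa hxb hab.
(* At x the two doubled terms cancel in [f], so x needs no special case. *)
pose h (c z : G) : R := (z == c)%:R + 2 * (adj c z)%:R.
pose f z := h a z - h b z.
have hx c : adj x c -> h c x = 2.
  by move=> hxc; rewrite /h (adj_neq hxc) adj_sym hxc add0r mulr1.
have hy c y : adj x c -> adj x y -> h c y = (y == c)%:R.
  move=> hxc hxy; rewrite /h (no_triangle hcyc _ hxy) ?mulr0 ?addr0 //.
  by rewrite adj_sym.
have hz c y z : adj x c -> adj x y -> adj y z -> z != x -> h c z = 2 * (y == c)%:R.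
  move=> hxc hxy hyz hzx; rewrite /h.
  have -> : (z == c) = false.
    by apply/eqP => e; move: (no_triangle hcyc hxy hyz); rewrite e hxc.
  rewrite add0r; congr (2 * (nat_of_bool _)%:R).
  apply/idP/eqP => [hcz|<- //]; apply/eqP/negPn/negP => /eqP hyc.
  by move/eqP: hzx; apply; exact: (no_square hcyc hxy hxc hyc hyz hcz).
have fx : f x = 0 by rewrite /f !hx // subrr.
have fy y : adj x y -> f y = (y == a)%:R - (y == b)%:R.
  by move=> hxy; rewrite /f !hy.
(* Only z = x contributes: there the second difference is -2 f y. *)
have fz y : adj x y -> \sum_(z <- nbr y) (f z - 2 * f y + f x) ^+ 2 = 4 * f y ^+ 2.
  move=> hxy; rewrite -(@sum_nbr_eq R G y x (fun=> 4 * f y ^+ 2)); last first.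
    by rewrite adj_sym.
  rewrite [LHS]big_seq [RHS]big_seq; apply: eq_bigr => z; rewrite mem_nbr => hyz.
  case: eqP => [->|/eqP hzx]; first by rewrite fx mulr1; ring.
  by rewrite fx {1}/f !(hz _ y) // fy // mulr0; ring.
have := hCD f x; rewrite Gamma2E // fx.
have -> : \sum_(y <- nbr x) (f y - 0) = 0.
  rewrite big_seq (eq_bigr (fun y => 1 * (y == a)%:R - 1 * (y == b)%:R)).
    by rewrite -big_seq sumrB !sum_nbr_eq // subrr.
  by move=> y; rewrite mem_nbr => /fy ->; ring.
rewrite (_ : \sum_(y <- nbr x) _ = \sum_(y <- nbr x)
    ((4 - (deg x + deg y)%:R) * (y == a)%:R + (4 - (deg x + deg y)%:R) * (y == b)%:R)).
  rewrite big_split /= !sum_nbr_eq // => hge.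
  have : (deg a + deg b + 2 * deg x)%:R <= 8%:R :> R.
    by move: hge; rewrite mul2n -addnn !natrD; lra.
  by rewrite ler_nat.
rewrite [LHS]big_seq [RHS]big_seq; apply: eq_bigr => y; rewrite mem_nbr => hxy.
have := fz y hxy; rewrite fx => ->; rewrite fy // subr0.
case: (y =P a) => [->|_]; last by case: eqP => _ /=; ring.
by case: eqP => // _ /=; ring.
Qed.

Local Close Scope ring_scope.

(** * Recognising a graph from a covering *)

(** The second condition on h lets paths be lifted from the graph to I, so
    connectivity makes h surjective; together with injectivity, it also makes h
    reflect adjacency. *)
Lemma iso_of_injective_covering (G : graph) (I : Type) (e : rel I) (h : I -> G) :
  inhabited I ->
  (forall i j, e i j -> adj (h i) (h j)) ->
  (forall i y, adj (h i) y -> exists2 j, e i j & h j = y) ->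
  injective h -> graph_iso (@adj G) e.
Proof.
move=> [i0] hom lift inj.
have reach p i : path adj (h i) p -> exists j, h j = last (h i) p.
  elim: p i => [|y p IH] i /=; first by exists i.
  by case/andP=> /lift[j _ <-]; exact: IH.
have surj y : exists j, h j = y.
  by have [p /reach[j hj] <-] := adj_connected (h i0) y; exists j.
have [g hg] := choice surj.
exists g; first by exists h => // i; exact/inj/hg.
move=> x y; apply/idP/idP => [|/hom]; last by rewrite !hg.
by rewrite -{1}(hg x) => /lift[j hij hj]; rewrite -hj (inj _ _ (hg (h j))).
Qed.

Lemma exists_neighbour (G : graph) (x : G) : exists y, adj x y.
Proof.
have [y hxy] : exists y, x <> y.
  have [a [b hab]] := graph_nontrivial G.
  by have [xa|xa] := pselect (x = a); [exists b; rewrite xa | exists a].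
have [[|z p] /= hp hl] := adj_connected x y; first by case: hxy.
by exists z; case/andP: hp.
Qed.

Definition max_deg2 (G : graph) :=
  forall x a b c : G, adj x a -> adj x b -> adj x c -> a <> b -> c = a \/ c = b.

Lemma max_deg2P (G : graph) : (forall x : G, (deg x <= 2)%N) -> max_deg2 G.
Proof.
move=> hdeg x a b c hxa hxb hxc /eqP hab.
have [->|hca] := eqVneq c a; first by left.
have [->|hcb] := eqVneq c b; first by right.
suff : (3 <= deg x)%N by rewrite leqNgt ltnS hdeg.
apply: (@uniq_leq_size _ [:: a; b; c]).
  by rewrite /= !inE negb_or hab (eq_sym a) hca (eq_sym b) hcb.
by move=> y; rewrite !inE mem_nbr => /or3P[] /eqP ->.
Qed.

(** * The branching case: stars *)

(** A graph in which every neighbour of x is a leaf has nothing beyond these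
    neighbours. *)
Lemma star_of_leaves (G : graph) (x : G) :
  (forall y z : G, adj x y -> adj y z -> z = x) ->
  graph_iso (@adj G) (@star_adj (deg x)).
Proof.
move=> leaf; pose h (u : option 'I_(deg x)) := if u is Some i then nth x (nbr x) i else x.
have adjh i : adj x (h (Some i)) by rewrite -mem_nbr mem_nth.
apply: (iso_of_injective_covering (h := h)); first by split; exact: None.
- by case=> [i|] [j|] // _; rewrite ?[adj (h (Some i)) _]adj_sym.
- case=> [i|] y /= hy.
    by exists None => //; rewrite /h (leaf _ _ (adjh i) hy).
  have hi : (index y (nbr x) < deg x)%N by rewrite index_mem mem_nbr.
  by exists (Some (Ordinal hi)); rewrite //= nth_index // mem_nbr.
- case=> [i|] [j|] //=.
  + move/eqP; rewrite nth_uniq ?nbr_uniq ?ltn_ord // => /eqP ij.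
    by congr Some; exact: val_inj.
  + by move=> e; move: (adjh i); rewrite /h e adj_irrefl.
  + by move=> e; move: (adjh j); rewrite /h -e adj_irrefl.
Qed.

(** * The cyclic case *)

Lemma cycle_adjE n (i j : 'I_n) :
  cycle_adj i j = (ordS i == j) || (ordS j == i).
Proof. by []. Qed.

Lemma ordS_ordS_neq n (i : 'I_n) : (2 < n)%N -> ordS (ordS i) <> i.
Proof.
move=> hn /(congr1 val) /=; have := ltn_ord i.
rewrite leq_eqVlt => /orP[/eqP e|hi].
  by rewrite e modnn modn_small; lia.
rewrite (modn_small hi); move: hi; rewrite leq_eqVlt => /orP[/eqP e|hi].
  by rewrite e modnn; lia.
by rewrite (modn_small hi); lia.
Qed.

Lemma cycle_nthS (T : Type) (e : rel T) (x0 : T) (c : seq T) (i : 'I_(size c)) :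
  cycle e c -> e (nth x0 c i) (nth x0 c (ordS i)).
Proof.
case: c i => [[]//|x p] i /(pathP x0) /(_ i).
rewrite size_rcons ltn_ord => /(_ isT).
rewrite -rcons_cons nth_rcons ltn_ord /=.
have := ltn_ord i; rewrite /= ltnS leq_eqVlt => /orP[/eqP e1|hi].
  by rewrite nth_rcons e1 ltnn eqxx modnn.
by rewrite nth_rcons hi modn_small.
Qed.

(** The successor and the predecessor on the cycle are two different neighbours,
    so in maximal degree two no edge leaves the cycle. *)
Lemma iso_cycle (G : graph) (c : seq G) :
  max_deg2 G -> graph_cycle c -> graph_iso (@adj G) (@cycle_adj (size c)).
Proof.
move=> hdeg [/andP[hcyc huniq] hsize].
have x0 : G by case: (c) hsize.
pose h (i : 'I_(size c)) := nth x0 c i.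
have inj : injective h.
  by move=> i j /eqP; rewrite nth_uniq // => /eqP /val_inj.
have step i : adj (h i) (h (ordS i)) by exact: cycle_nthS.
apply: (iso_of_injective_covering (h := h)) => //.
- by split; exact: (Ordinal (ltn_trans (ltn0Sn 1) hsize)).
- by move=> i j; rewrite cycle_adjE => /orP[] /eqP <- //; rewrite adj_sym.
- move=> i y hy; pose j := ord_pred i.
  have ji : ordS j = i by rewrite /j ord_predK.
  have := step j; rewrite ji adj_sym => hj.
  have hne : h (ordS i) <> h j.
    by move/inj => e; apply: (ordS_ordS_neq (i := j) hsize); rewrite ji.
  case: (hdeg _ _ _ _ (step i) hj hy hne) => ->.
    by exists (ordS i); rewrite // cycle_adjE eqxx.
  by exists j; rewrite // cycle_adjE ji eqxx orbT.
Qed.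

(** * Walks without backtracking *)

Lemma path_map_iota (T : Type) (e : rel T) (u : nat -> T) i n :
  (forall m, (i <= m < i + n)%N -> e (u m) (u m.+1)) ->
  path e (u i) [seq u m | m <- iota i.+1 n].
Proof.
elim: n i => [//|n IH] i h /=; rewrite h ?IH //; first by move=> m hm; apply: h; lia.
by lia.
Qed.

(** At a return of minimal length the vertices in between are distinct, so the
    walk closes up to a cycle; lengths one and two are excluded by irreflexivity
    and by the absence of backtracking.  The hypotheses concern the window
    [i, i + n] only, because a walk in a finite path has to be stopped at the
    end. *)
Lemma forest_walk_inj (G : graph) (u : nat -> G) i n :
  (forall c : seq G, ~ graph_cycle c) ->
  (forall m, (i <= m < i + n)%N -> adj (u m) (u m.+1)) ->
  (forall m, (i <= m)%N -> (m.+2 <= i + n)%N -> u m <> u m.+2) ->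
  (0 < n)%N -> u i <> u (i + n).
Proof.
move=> forest; elim/ltn_ind: n i => -[//|[|[|n]]] IH i hadj hback _ e.
- have /hadj : i <= i < i + 1 by lia.
  by rewrite e addn1 adj_irrefl.
- by apply: (hback i); rewrite ?e ?addn2 //; lia.
apply: (forest [seq u m | m <- iota i n.+3]); split; last by rewrite size_map size_iota.
apply/andP; split.
  have := @path_map_iota _ adj u i n.+3 hadj.
  by rewrite -[X in iota _ X]addn1 iotaD map_cat /= cats1 addSnnS -e.
rewrite map_inj_in_uniq ?iota_uniq // => a b; rewrite !mem_iota => ha hb.
have key a' b' : i <= a' -> a' < b' -> b' < i + n.+3 -> u a' <> u b'.
  move=> h1 h2 h3; rewrite -(subnKC (ltnW h2)); apply: IH; try lia.
    by move=> m hm; apply: hadj; lia.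
  by move=> m hm hm'; apply: hback; lia.
by case: (ltngtP a b) => // hab eab; [case: (key a b) | case: (key b a)] => //; lia.
Qed.

Definition leaf (G : graph) (x : G) := forall y z : G, adj x y -> adj x z -> y = z.

Lemma not_leaf_other (G : graph) (x p : G) :
  ~ leaf x -> exists2 q, adj x q & q <> p.
Proof.
move=> hx; apply: contrapT => none; apply: hx => y z hy hz.
have eqp q : adj x q -> q = p.
  by move=> hq; apply: contrapT => hne; apply: none; exists q.
by rewrite (eqp y) // (eqp z).
Qed.

(** The state of the walk is its last arc: the next vertex must differ from the
    previous one whenever there is a choice, that is, away from leaves. *)
Lemma exists_walk (G : graph) (x0 x1 : G) : adj x0 x1 ->
  exists u : nat -> G, [/\ u 0 = x0, u 1 = x1,
    forall n, adj (u n) (u n.+1) &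
    forall n, ~ leaf (u n.+1) -> u n <> u n.+2].
Proof.
move=> h01.
(* At a leaf the walk turns back, so that it is defined for all times. *)
have next (a : G * G) : exists q, adj a.1 a.2 ->
    adj a.2 q /\ (~ leaf a.2 -> a.1 <> q).
  have [hl|hl] := pselect (leaf a.2); first by exists a.1; rewrite adj_sym.
  by have [q hq hqp] := not_leaf_other a.1 hl; exists q => _; split=> // _ /esym.
have [s hs] := choice next.
pose arc n := iter n (fun a : G * G => (a.2, s a)) (x0, x1).
have arc_adj n : adj (arc n).1 (arc n).2.
  by elim: n => [//|n IH] /=; case: (hs _ IH).
exists (fun n => (arc n).1); split=> // n.
by case: (hs _ (arc_adj n)).
Qed.

(** * Trees of maximal degree two *)

Lemma neighbours_of_inner (G : graph) (p x q y : G) :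
  max_deg2 G -> adj p x -> adj x q -> p <> q -> adj x y -> y = p \/ y = q.
Proof. by rewrite adj_sym => hdeg hxp hxq hpq hxy; exact: (hdeg x). Qed.

Lemma iso_path (G : graph) (u : nat -> G) (k : nat) :
  max_deg2 G -> (forall c : seq G, ~ graph_cycle c) ->
  (forall n, adj (u n) (u n.+1)) ->
  (forall n, (n < k)%N -> u n <> u n.+2) ->
  leaf (u 0) -> leaf (u k.+1) -> graph_iso (@adj G) (@path_adj k.+1).
Proof.
move=> hdeg forest hadj hback leaf0 leafk.
apply: (iso_of_injective_covering (h := fun i : 'I_k.+2 => u i)).
- by split; exact: ord0.
- by move=> i j /orP[] /eqP <- //; rewrite adj_sym.
- move=> [[|i] hi] y /= hy.
    by exists (inord 1); rewrite /path_adj ?inordK //; exact: (leaf0 (u 1)).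
  have hpi : i < k.+2 by exact: ltnW.
  have pred : exists2 j, path_adj (Ordinal hi) j & u j = u i.
    by exists (Ordinal hpi); rewrite // /path_adj /= eqxx orbT.
  have := hi; rewrite ltnS leq_eqVlt => /orP[/eqP [e]|hik].
    by rewrite (leafk y (u i)) -?e // adj_sym.
  case: (neighbours_of_inner hdeg (hadj i) (hadj i.+1) (hback _ _) hy) => // -> //.
  by exists (Ordinal (n := k.+2) (m := i.+2) hik); rewrite // /path_adj /= eqxx.
- have neq (a b : 'I_k.+2) : a < b -> u a <> u b.
    move=> hab; rewrite -(subnKC (ltnW hab)); have hb := ltn_ord b.
    apply: (forest_walk_inj forest) => [m _|m hm hm'|]; [exact: hadj|apply: hback|]; lia.
  by move=> a b /= e; apply: val_inj; case: (ltngtP a b) => // /neq; rewrite e.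
Qed.

Lemma iso_half_line (G : graph) (u : nat -> G) :
  max_deg2 G -> (forall c : seq G, ~ graph_cycle c) ->
  (forall n, adj (u n) (u n.+1)) -> (forall n, u n <> u n.+2) ->
  leaf (u 0) -> graph_iso (@adj G) half_line_adj.
Proof.
move=> hdeg forest hadj hback leaf0.
apply: (iso_of_injective_covering (h := u)).
- by split; exact: 0.
- by move=> i j /orP[] /eqP <- //; rewrite adj_sym.
- move=> [|i] y hy; first by exists 1 => //; exact: (leaf0 (u 1)).
  case: (neighbours_of_inner hdeg (hadj i) (hadj i.+1) (hback i) hy) => ->.
    by exists i; rewrite // /half_line_adj eqxx orbT.
  by exists i.+2; rewrite // /half_line_adj eqxx.
- have neq a b : a < b -> u a <> u b.
    move=> hab; rewrite -(subnKC (ltnW hab)).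
    by apply: (forest_walk_inj forest) => //; lia.
  by move=> a b e; case: (ltngtP a b) => // /neq; rewrite e.
Qed.

Lemma iso_line (G : graph) (v : int -> G) :
  max_deg2 G -> (forall c : seq G, ~ graph_cycle c) ->
  (forall i, adj (v i) (v (i + 1)%R)) -> (forall i, v i <> v (i + 2)%R) ->
  graph_iso (@adj G) line_adj.
Proof.
move=> hdeg forest hadj hback.
apply: (iso_of_injective_covering (h := v)).
- by split; exact: 0%R.
- by move=> i j /orP[] /eqP <- //; rewrite adj_sym.
- move=> i y hy.
  have hp : adj (v (i - 1)%R) (v i) by have := hadj (i - 1)%R; rewrite subrK.
  have hne : v (i - 1)%R <> v (i + 1)%R.
    by have := hback (i - 1)%R; rewrite (_ : (i - 1 + 2)%R = (i + 1)%R) //; lia.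
  case: (neighbours_of_inner hdeg hp (hadj i) hne hy) => ->.
    by exists (i - 1)%R; rewrite // /line_adj subrK eqxx orbT.
  by exists (i + 1)%R; rewrite // /line_adj eqxx.
- have neq (a b : int) : (a < b)%R -> v a <> v b.
    move=> hab; pose u n := v (a + Posz n)%R.
    have -> : v a = u 0 by rewrite /u addr0.
    have -> : v b = u (0 + `|b - a|%N) by rewrite /u; congr v; lia.
    apply: (forest_walk_inj forest) => [m _|m _ _|]; last by lia.
      by rewrite /u -addn1 PoszD addrA; exact: hadj.
    by rewrite /u -addn2 PoszD addrA; exact: hback.
  by move=> a b e; case: (ltgtP a b) => // /neq; rewrite e.
Qed.

(** Two one-way walks leave the same vertex through different neighbours and are
    glued there. *)
Lemma exists_two_way_walk (G : graph) :
  (forall x : G, ~ leaf x) ->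
  exists v : int -> G, (forall i, adj (v i) (v (i + 1)%R)) /\
    (forall i, v i <> v (i + 2)%R).
Proof.
move=> noleaf; have [x _] := graph_nontrivial G.
have [a hxa] := exists_neighbour x.
have [b hxb hba] := not_leaf_other a (noleaf x).
have [u [u0 u1 uadj uback]] := exists_walk hxa.
have [w [w0 w1 wadj wback]] := exists_walk hxb.
exists (fun i => match i with Posz n => u n | Negz n => w n.+1 end).
split=> -[n|n].
- by rewrite -PoszD addn1.
- case: n => [|n].
    by rewrite (_ : (Negz 0 + 1)%R = Posz 0) // adj_sym u0 -w0.
  by rewrite (_ : (Negz n.+1 + 1)%R = Negz n) 1?adj_sym //; lia.
- by rewrite -PoszD addn2; exact: uback.
- case: n => [|[|n]].
  + by rewrite (_ : (Negz 0 + 2)%R = Posz 1) // u1 w1.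
  + by rewrite (_ : (Negz 1 + 2)%R = Posz 0) // u0 -w0 => /esym; exact: wback.
  + rewrite (_ : (Negz n.+2 + 2)%R = Negz n); last by lia.
    by move=> /esym; exact: wback.
Qed.

(** A walk from a leaf either meets a second leaf, the first of which ends a
    finite path, or goes on for ever; without leaves the walk continues in both
    directions. *)
Lemma max_deg2_forest_classification (G : graph) :
  max_deg2 G -> (forall c : seq G, ~ graph_cycle c) ->
  (exists2 k : nat, (1 <= k)%N & graph_iso (@adj G) (@path_adj k)) \/
  graph_iso (@adj G) line_adj \/ graph_iso (@adj G) half_line_adj.
Proof.
move=> hdeg forest.
have [[x leafx]|noleaf] := pselect (exists x : G, leaf x); last first.
  have [|v [vadj vback]] := @exists_two_way_walk G.
    by move=> x hx; apply: noleaf; exists x.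
  by right; left; exact: (iso_line hdeg forest vadj vback).
have [y hxy] := exists_neighbour x.
have [u [u0 u1 uadj uback]] := exists_walk hxy.
have leaf0 : leaf (u 0) by rewrite u0.
have [stop|nostop] := pselect (exists n, `[< leaf (u n.+1) >]); last first.
  right; right; apply: (iso_half_line hdeg forest uadj) => // n.
  by apply: uback => hn; apply: nostop; exists n; exact/asboolP.
left; have [k /asboolP leafk kmin] := ex_minnP stop.
exists k.+1 => //; apply: (iso_path hdeg forest uadj) => // n hn.
by apply: uback => /asboolP /kmin; rewrite leqNgt hn.
Qed.

(** * The classification *)

(** The degree bound gives d y + d y' <= 8 - 2 * 3 for two neighbours y and y',
    while d y' >= 1. *)
Lemma star_of_branching (R : realType) (G : weighted_graph R) (x : G) :
  unweighted_physical G -> CD_0_infty G -> no_short_cycle G ->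
  (3 <= deg x)%N -> graph_iso (@adj G) (@star_adj (deg x)).
Proof.
move=> hG hCD hcyc hx; apply: star_of_leaves => y z hxy hyz.
have [y' hxy' hy'] : exists2 y', adj x y' & y' <> y.
  apply: not_leaf_other => hl.
  suff : (deg x <= 1)%N by lia.
  apply: (@uniq_leq_size _ (nbr x) [:: y] (nbr_uniq x)) => t.
  by rewrite mem_nbr inE => ht; rewrite (hl t y).
have bound := CD_deg_bound hG hCD hcyc hxy hxy' (nesym hy').
have y'x : (0 < deg y')%N by apply: (@deg_gt0 _ _ x); rewrite adj_sym.
have : (deg y <= 1)%N by lia.
have yx : adj y x by rewrite adj_sym.
move: yx hyz; rewrite -!mem_nbr /deg.
by case: (nbr y) => [//|a [|//]]; rewrite !inE => /eqP -> /eqP ->.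
Qed.

Theorem theorem4p4 (R : realType) (G : weighted_graph R) :
  unweighted_physical G ->
  CD_0_infty G ->
  ((5%:R : R)%:E <= girth R G)%E ->
  ((exists2 k : nat, (1 <= k)%N & graph_iso (@adj G) (@path_adj k)) \/
   (exists2 n : nat, (5 <= n)%N & graph_iso (@adj G) (@cycle_adj n)) \/
   graph_iso (@adj G) line_adj \/
   graph_iso (@adj G) half_line_adj) \/
  (exists2 n : nat, (3 <= n)%N & graph_iso (@adj G) (@star_adj n)).
Proof.
move=> hG hCD hgirth.
have hcyc : no_short_cycle G by move=> c; exact: cycle_size_ge5 hgirth.
have [[x hx]|small] := pselect (exists x : G, 3 <= deg x).
  by right; exists (deg x) => //; exact: star_of_branching.
have hdeg : max_deg2 G.
  apply: max_deg2P => x; rewrite leqNgt; apply/negP => hx.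
  by apply: small; exists x.
left; have [[c hc]|forest] := pselect (exists c : seq G, graph_cycle c).
  by right; left; exists (size c); [exact: hcyc | exact: iso_cycle].
have [|hpath|hline] := max_deg2_forest_classification hdeg.
- by move=> c hc; apply: forest; exists c.
- by left.
- by right; right.
Qed.
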